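(* Fix $\mu_0$ and $\mu_1$, and let $n$ be the number of agents. Assume that the log-likelihood ratio $x(\omega)$ (for given $\omega\in\Omega$), as well as the cumulative distribution functions of $\nu_0$ and $\nu_1$, can be calculated in constant time. Then there exists an algorithm with running time $O(nt)$ which, given agent $i$'s private signal $W_i$ and the votes $\bar V^{t-1}=\{V_j(t'): j\in[n],\ t'<t\}$, calculates $V_i(t)$, agent $i$'s vote at time $t$.
   Context: Signals. $\mu_0$ and $\mu_1$ are probability measures on a measurable space $(\Omega,\mathcal{O})$ such that: (1) $\mu_0$ and $\mu_1$ are mutually absolutely continuous, so that the Radon-Nikodym derivative $\frac{d\mu_1}{d\mu_0}(\omega)$ exists and is (taken to be) non-zero for all $\omega\in\Omega$; (2) if $W$ is distributed according to $\frac12\mu_0+\frac12\mu_1$ and $X=\log\frac{d\mu_1}{d\mu_0}(W)$, then the distribution of $X$ is non-atomic (no point has positive mass). Log-likelihood ratio. $x(\omega)=\log\frac{d\mu_1}{d\mu_0}(\omega)$ for $\omega\in\Omega$; for $s\in\{0,1\}$, $\nu_s$ is the distribution on $\mathbb{R}$ of $x(A)$ when $A\sim\mu_s$. Probability space. $[n]=\{1,\dots,n\}$ is the set of agents. Let $\delta_0,\delta_1$ be the point masses at $0$ and $1$ on $\{0,1\}$. The random variables $S\in\{0,1\}$ (the state of the world) and $(W_1,\dots,W_n)\in\Omega^n$ (the private signals, $W_i$ being that of agent $i$) have joint law $\mathbb{P}=\frac12\,\delta_0\otimes\mu_0^{\otimes n}+\frac12\,\delta_1\otimes\mu_1^{\otimes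 n}$. That is, $S$ is uniform on $\{0,1\}$ and, conditioned on $S$, the $W_i$ are i.i.d. with law $\mu_S$. Votes. For $t\in\{1,2,\dots\}$ and $i\in[n]$, the vote $V_i(t)$ is defined recursively in $t$ by $V_i(t)=1$ if $\mathbb{P}[S=1\mid W_i,\bar V^{t-1}]>1/2$ and $V_i(t)=0$ otherwise, where $\bar V^{t}=\{V_j(t'): j\in[n],\ 1\le t'\le t\}$ is the collection of all agents' votes up to time $t$ ($\bar V^0$ is empty). Conditional probabilities are defined up to $\mathbb{P}$-null sets, so correctness of the output is understood $\mathbb{P}$-almost surely. Computational model. The algorithm has access to oracles that, in constant time, return $x(\omega)$ for a given $\omega\in\Omega$ and the values of the cumulative distribution functions of $\nu_0$ and $\nu_1$ at a given point; elementary operations on (extended) real numbers (arithmetic, comparison, logarithm) have unit cost. The constant implied by $O(nt)$ does not depend on $n$, $t$ or $i$. *)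

(* Defs.v *)
From HB Require Import structures.
From mathcomp Require Import all_boot all_order all_algebra.
From mathcomp Require Import all_classical all_reals all_analysis.
From mathcomp Require Import measurable_realfun.

Set Implicit Arguments.
Unset Strict Implicit.
Unset Printing Implicit Defensive.

Import Order.TTheory GRing.Theory Num.Theory.
Import numFieldNormedType.Exports.

Local Open Scope classical_set_scope.
Local Open Scope ring_scope.
Local Open Scope ereal_scope.
Local Open Scope charge_scope.

Section log_likelihood_ratio.
Context d (Om : measurableType d) (R : realType).

Definition llr (f : {mfun Om >-> R}) (w : Om) : R := ln (f w).

Let measurable_llr (f : {mfun Om >-> R}) : measurable_fun setT (llr f).
Proof.
apply: (@measurableT_comp _ _ _ _ _ _ (@ln R)); first exact: measurable_ln.
exact: measurable_funP.
Qed.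

HB.instance Definition _ (f : {mfun Om >-> R}) :=
  isMeasurableFun.Build _ _ _ _ (llr f) (measurable_llr f).

End log_likelihood_ratio.

Section signals.
Context d (Om : measurableType d) (R : realType).

Definition mixture (mu0 mu1 : probability Om R) : set Om -> \bar R :=
  measure_add (mscale ((2^-1)%:nng)%R mu0) (mscale ((2^-1)%:nng)%R mu1).

(* [f] is the chosen version of dmu1/dmu0: real-valued and everywhere non-zero,
   hence (being a density) everywhere positive. *)
Definition signal_model (mu0 mu1 : probability Om R) (f : {mfun Om >-> R}) :=
  [/\ mu0 `<< mu1, mu1 `<< mu0,
      ae_eq mu0 setT ('d (charge_of_finite_measure mu1) '/d mu0) (EFin \o f),
      (forall w, (0 < f w)%R)
    & forall c : R, pushforward (mixture mu0 mu1) (llr f) [set c] = 0].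

End signals.

Section voting.
Context d (Om : measurableType d) (R : realType).
Context d' (T : measurableType d') (P : probability T R) (n : nat).
Variables (S : {mfun T >-> bool}) (W : 'I_n -> {mfun T >-> Om}).

(* The joint law of (S, (W_i)_i) is
     1/2 delta_0 (x) mu0^(x)n + 1/2 delta_1 (x) mu1^(x)n,
   stated on measurable rectangles, where it determines the law. *)
Definition has_joint_law (mu0 mu1 : probability Om R) :=
  forall (B : set bool) (A : 'I_n -> set Om), (forall i, measurable (A i)) ->
  P (S @^-1` B `&` \bigcap_(i in [set: 'I_n]) (W i @^-1` A i)) =
    (2^-1)%:E * (\d_false B * \prod_(i < n) mu0 (A i)) +
    (2^-1)%:E * (\d_true B * \prod_(i < n) mu1 (A i)).

(* [p] is a version of the conditional probability P[E | G]. *)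
Definition is_cond_prob (G : set (set T)) (E : set T) (p : T -> R) :=
  [/\ forall B : set R, measurable B -> G (p @^-1` B),
      P.-integrable setT (EFin \o p)
    & forall A, G A -> \int[P]_(w in A) (p w)%:E = P (A `&` E)].

(* The sigma-algebra generated by W_i and the votes V_j(t'), 1 <= t' < t. *)
Definition info (V : nat -> 'I_n -> T -> bool) (i : 'I_n) (t : nat) :
    set (set T) :=
  <<s preimage_set_system setT (W i) measurable `|`
      \bigcup_(k in [set k | (0 < k < t)%N])
        \bigcup_(j in [set: 'I_n]) preimage_set_system setT (V k j) measurable
  >>.

(* [V t i] is agent i's vote at time t, for t >= 1; [V 0] plays no role. *)
Definition is_vote_process (V : nat -> 'I_n -> T -> bool) :=
  forall t i, (0 < t)%N ->
  exists2 p : T -> R, is_cond_prob (info V i t) (S @^-1` [set true]) p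
    & forall w, V t i w = (2^-1 < p w)%R.

End voting.

(* The model of computation: while programs over two random-access memories,
   one holding natural numbers and one holding extended reals. A program is a
   finite text without real constants. Integer arithmetic is restricted to
   addition and truncated subtraction. [IVote k j] reads row k, column j of the
   table of votes, and [RCdf b a] is the distribution function of nu_b at a. *)

Inductive iexp :=
| INum of nat
| IGet of iexp
| IVote of iexp & iexp
| IAdd of iexp & iexp
| ISub of iexp & iexp.

Inductive rexp :=
| RNat of iexp
| RInfty
| RGet of iexp
| RSignal
| RCdf of bool & rexp
| RAdd of rexp & rexp
| RSub of rexp & rexp
| RMul of rexp & rexp
| RDiv of rexp & rexp
| RLn of rexp.

Inductive bexp :=
| BLtI of iexp & iexp
| BLtR of rexp & rexp
| BNot of bexp.

Inductive cmd :=
| Skip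
| ISet of iexp & iexp
| RSet of iexp & rexp
| Seq of cmd & cmd
| If of bexp & cmd & cmd
| While of bexp & cmd.

Section semantics.
Variable R : realType.

(* What a program can consult without being able to modify it: the value of the
   log-likelihood ratio at the private signal, the two cumulative distribution
   functions, and the table of votes. *)
Record env := Env {
  env_signal : \bar R;
  env_cdf : bool -> \bar R -> \bar R;
  env_vote : nat -> nat -> nat }.

Record state := State { imem : nat -> nat; rmem : nat -> \bar R }.

Definition upd (A : Type) (m : nat -> A) (a : nat) (v : A) : nat -> A :=
  fun b => if b == a then v else m b.

Variable E : env.

Fixpoint ieval (s : state) (e : iexp) : nat :=
  match e with
  | INum k => k
  | IGet a => imem s (ieval s a)
  | IVote k j => env_vote E (ieval s k) (ieval s j)
  | IAdd a b => (ieval s a + ieval s b)%N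
  | ISub a b => (ieval s a - ieval s b)%N
  end.

Fixpoint reval (s : state) (e : rexp) : \bar R :=
  match e with
  | RNat a => ((ieval s a)%:R)%:E
  | RInfty => +oo
  | RGet a => rmem s (ieval s a)
  | RSignal => env_signal E
  | RCdf b a => env_cdf E b (reval s a)
  | RAdd a b => reval s a + reval s b
  | RSub a b => reval s a - reval s b
  | RMul a b => reval s a * reval s b
  | RDiv a b => reval s a / reval s b
  | RLn a => lne (reval s a)
  end.

Fixpoint beval (s : state) (e : bexp) : bool :=
  match e with
  | BLtI a b => (ieval s a < ieval s b)%N
  | BLtR a b => reval s a < reval s b
  | BNot b => ~~ beval s b
  end.

End semantics.

(* Every operation, oracle call and memory access in an expression costs 1. *)
Fixpoint icost (e : iexp) : nat :=
  match e with
  | INum _ => 1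
  | IGet a => (icost a).+1
  | IVote a b | IAdd a b | ISub a b => (icost a + icost b).+1
  end.

Fixpoint rcost (e : rexp) : nat :=
  match e with
  | RInfty | RSignal => 1
  | RNat a | RGet a => (icost a).+1
  | RCdf _ a | RLn a => (rcost a).+1
  | RAdd a b | RSub a b | RMul a b | RDiv a b => (rcost a + rcost b).+1
  end.

Fixpoint bcost (e : bexp) : nat :=
  match e with
  | BLtI a b => (icost a + icost b).+1
  | BLtR a b => (rcost a + rcost b).+1
  | BNot b => (bcost b).+1
  end.

(* [exec E c s k s']: started in state [s], the program [c] terminates in state
   [s'] after [k] steps. *)
Inductive exec (R : realType) (E : env R) :
    cmd -> state R -> nat -> state R -> Prop :=
| ExecSkip s : exec E Skip s 1 s
| ExecISet s a e :
    exec E (ISet a e) s (icost a + icost e).+1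
      (State (upd (imem s) (ieval E s a) (ieval E s e)) (rmem s))
| ExecRSet s a e :
    exec E (RSet a e) s (icost a + rcost e).+1
      (State (imem s) (upd (rmem s) (ieval E s a) (reval E s e)))
| ExecSeq c1 c2 s1 s2 s3 k1 k2 :
    exec E c1 s1 k1 s2 -> exec E c2 s2 k2 s3 ->
    exec E (Seq c1 c2) s1 (k1 + k2) s3
| ExecIf b c1 c2 s s' k :
    exec E (if beval E s b then c1 else c2) s k s' ->
    exec E (If b c1 c2) s (bcost b + k).+1 s'
| ExecWhileF b c s :
    beval E s b = false -> exec E (While b c) s (bcost b).+1 s
| ExecWhileT b c s1 s2 s3 k1 k2 :
    beval E s1 b = true -> exec E c s1 k1 s2 -> exec E (While b c) s2 k2 s3 ->
    exec E (While b c) s1 (bcost b + k1 + k2).+1 s3.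

Lemma exec_det (R : realType) (E : env R) c s k1 s1 k2 s2 :
  exec E c s k1 s1 -> exec E c s k2 s2 -> k1 = k2 /\ s1 = s2.
Proof.
move=> e1; elim: e1 k2 s2 => {c s k1 s1}.
- by move=> s k2 s2 e2; inversion e2.
- by move=> s a e k2 s2 e2; inversion e2.
- by move=> s a e k2 s2 e2; inversion e2.
- move=> c1 c2 s1 s2 s3 k1 k2 _ IH1 _ IH2 k s e2.
  inversion e2 as [| | |? ? ? s' ? k1' k2' f1 f2| | |]; subst.
  by have [<- ss] := IH1 _ _ f1; subst; have [<- <-] := IH2 _ _ f2.
- move=> b c1 c2 s s' k _ IH k2 s2 e2.
  inversion e2 as [| | | |? ? ? ? ? k' f1| |]; subst.
  by have [<- <-] := IH _ _ f1.
- by move=> b c s bF k2 s2 e2; inversion e2; subst => //; congruence.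
- move=> b c s1 s2 s3 k1 k2 bT _ IH1 _ IH2 k s e2.
  inversion e2 as [| | | | | |? ? ? s' ? k1' k2' ? f1 f2]; subst.
    by congruence.
  by have [<- ss] := IH1 _ _ f1; subst; have [<- <-] := IH2 _ _ f2.
Qed.

Section algorithm.
Context d (Om : measurableType d) (R : realType).
Variables (mu0 mu1 : probability Om R) (f : {mfun Om >-> R}).

(* The distribution function of nu_0 (b = false) or nu_1 (b = true), extended
   to the infinite points by its limits. *)
Definition cdf_oracle (b : bool) (a : \bar R) : \bar R :=
  match a with
  | r%:E => if b then cdf (llr f : {RV mu1 >-> R}) r
            else cdf (llr f : {RV mu0 >-> R}) r
  | +oo => 1
  | -oo => 0
  end.

(* Row k of the table holds the votes at time k + 1; reads outside the table
   return 0, so that nothing beyond time t - 1 can be consulted. *)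
Definition read_vote n t (h : 'M[bool]_(t.-1, n)) (k j : nat) : nat :=
  match insub k, insub j with
  | Some k', Some j' => h k' j'
  | _, _ => 0%N
  end.

Definition input_env n t (w : Om) (h : 'M[bool]_(t.-1, n)) : env R :=
  Env (llr f w)%:E cdf_oracle (read_vote h).

Definition input_state (n t i : nat) : state R :=
  State (nth 0%N [:: n; t; i]) (fun=> 0).

(* On input n, t, i, the signal w and the votes h, the program c halts after at
   most k steps with the output v in cell 0. *)
Definition computes_within (c : cmd) n t (i : 'I_n) (w : Om)
    (h : 'M[bool]_(t.-1, n)) (k : nat) (v : bool) :=
  exists k' s', [/\ exec (input_env w h) c (input_state n t i) k' s',
                    (k' <= k)%N & imem s' 0%N = v].

End algorithm.

Definition history (T : Type) n (V : nat -> 'I_n -> T -> bool) (t : nat)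
    (w : T) : 'M[bool]_(t.-1, n) :=
  (\matrix_(k, j) V k.+1 j w)%R.

(* Main.v *)
Require Import Defs.
From mathcomp Require Import all_boot all_order all_algebra.
From mathcomp Require Import all_classical all_reals all_analysis.
From mathcomp Require Import measurable_realfun zify ring lra.

(** Why the theorem is true.

    Fix a table [u] of votes for the times 1, ..., m.  Given the state, the
    signals are independent, and each agent's next vote is a function of the
    table and of her own signal alone.  Hence the signals that produce [u] form
    a rectangle: the signal of agent [j] ranges over a set [cell u m j], whatever
    the signals of the others are ([same_votes_cell]).  By the product form of
    the joint law, an agent [i] who sees [u] and the signal [w] has likelihood
    ratio [f w * \prod_(j != i) mu1 (cell u m j) / mu0 (cell u m j)] between the
    two states, and the prior is uniform; so she votes 1 exactly when [f w]
    exceeds the reciprocal of that product, her [threshold].  Her next cell is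
    the present one cut by this comparison, so that every cell has the form
    [{a < f <= 1 / g}], an interval in the likelihood ratio.

    Conditional probabilities are determined up to null sets only, so the rule
    holds almost surely ([vote_of_same_votes]).  The event where an agent who
    sees [u] departs from it is the union of two events belonging to her
    information: on one the conditional probability of [S = 1] exceeds 1/2 while
    the likelihoods say at most 1/2, on the other it is the opposite.
    Integrating the conditional probability over each of them forces both to be
    null.  The induction on time is [vote_rational].

    The mass of an interval is a difference of two values of a distribution
    function, so an interval costs two numbers per agent.  The threshold of
    agent [j] is [r_j / \prod_l r_l], where [r_l] is the ratio of the two masses
    of the cell of agent [l]: one product serves all agents, and a row of [n]
    votes is processed in O(n) operations.  The extended real arithmetic of the
    program is exact as long as all cells have positive mass ([cutoffE],
    [bounds_tracked]); tables with a null cell almost surely do not occur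
    ([same_votes_pos]), and on them the program halts within the same bound with
    an irrelevant answer. *)

Set Implicit Arguments.
Unset Strict Implicit.
Unset Printing Implicit Defensive.

Import Order.TTheory GRing.Theory Num.Theory.
Import numFieldNormedType.Exports.

Local Open Scope classical_set_scope.
Local Open Scope ring_scope.
Local Open Scope ereal_scope.
Local Open Scope charge_scope.

(** * Running straight-line programs and counting loops *)

Fixpoint straight (c : cmd) : bool :=
  match c with
  | Seq c1 c2 | If _ c1 c2 => straight c1 && straight c2
  | While _ _ => false
  | _ => true
  end.

(** For a conditional both branches are charged, so that the cost of a
    straight-line program does not depend on the state. *)
Fixpoint cost (c : cmd) : nat :=
  match c with
  | ISet a e => (icost a + icost e).+1
  | RSet a e => (icost a + rcost e).+1
  | Seq c1 c2 => (cost c1 + cost c2)%N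
  | If b c1 c2 => (bcost b + (cost c1 + cost c2)).+1
  | _ => 1%N
  end.

Section runs.
Context (R : realType) (E : env R).
Implicit Types (s : state R) (c : cmd).

Fixpoint run c s : state R :=
  match c with
  | ISet a e => State (upd (imem s) (ieval E s a) (ieval E s e)) (rmem s)
  | RSet a e => State (imem s) (upd (rmem s) (ieval E s a) (reval E s e))
  | Seq c1 c2 => run c2 (run c1 s)
  | If b c1 c2 => if beval E s b then run c1 s else run c2 s
  | _ => s
  end.

Definition runs c s K s' := exists2 k, (k <= K)%N & exec E c s k s'.

(** Without loops, execution is evaluation: running times and final states of
    such programs are obtained by computation. *)
Lemma runs_straight c s : straight c -> runs c s (cost c) (run c s).
Proof.
elim: c s => [|a e|a e|c1 IH1 c2 IH2|b c1 IH1 c2 IH2|//] s /=.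
- by move=> _; exists 1%N => //; exact: ExecSkip.
- by move=> _; eexists; last exact: ExecISet.
- by move=> _; eexists; last exact: ExecRSet.
- move=> /andP[/(IH1 s)[k1 le1 e1] /(IH2 (run c1 s))[k2 le2 e2]].
  by exists (k1 + k2)%N; [exact: leq_add|exact: ExecSeq e1 e2].
- move=> /andP[/(IH1 s)[k1 le1 e1] /(IH2 s)[k2 le2 e2]].
  case: ifPn => bE.
    exists (bcost b + k1).+1; first by lia.
    by apply: ExecIf; rewrite bE.
  exists (bcost b + k2).+1; first by lia.
  by apply: ExecIf; rewrite (negbTE bE).
Qed.

Lemma runs_seq c1 c2 s1 s2 s3 K1 K2 :
  runs c1 s1 K1 s2 -> runs c2 s2 K2 s3 -> runs (Seq c1 c2) s1 (K1 + K2) s3.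
Proof.
move=> [k1 le1 e1] [k2 le2 e2].
by exists (k1 + k2)%N; [exact: leq_add|exact: ExecSeq e1 e2].
Qed.

Lemma runs_leq c s s' K K' : (K <= K')%N -> runs c s K s' -> runs c s K' s'.
Proof. by move=> KK' [k kK e]; exists k => //; exact: leq_trans KK'. Qed.

End runs.

Definition incr (x : nat) : cmd :=
  ISet (INum x) (IAdd (IGet (INum x)) (INum 1)).

Definition for_loop (x : nat) (bound : iexp) (body : cmd) : cmd :=
  Seq (ISet (INum x) (INum 0))
      (While (BLtI (IGet (INum x)) bound) (Seq body (incr x))).

(** Cost of [N] iterations of a body of cost [K], [b] being the cost of the bound:
    an iteration adds the test and the increment, [b + 10] steps; initializing the
    counter and the last, failing test add [b + 7]. *)
Definition for_cost (N K b : nat) : nat := (N * (K + b + 10) + b + 7)%N.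

Definition set_int (R : realType) (x m : nat) (s : state R) : state R :=
  State (upd (imem s) x m) (rmem s).

(** The loop rule: [I m] is the invariant when the counter is [m].  The bound is
    evaluated anew at each test, whence the second hypothesis. *)
Lemma runs_for_loop (R : realType) (E : env R) x bound body N K
    (I : nat -> state R -> Prop) s :
  I 0%N (set_int x 0 s) ->
  (forall m s', I m s' -> imem s' x = m /\ ieval E s' bound = N) ->
  (forall m s', (m < N)%N -> I m s' -> exists2 s'',
     runs E body s' K s'' & I m.+1 (set_int x (imem s'' x).+1 s'')) ->
  exists2 s', runs E (for_loop x bound body) s
                (for_cost N K (icost bound)) s' & I N s'.
Proof.
move=> I0 Iout step.
suff loop j m s0 : (m + j = N)%N -> I m s0 -> exists2 s', runs E
      (While (BLtI (IGet (INum x)) bound) (Seq body (incr x))) s0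
      (j * (K + icost bound + 10) + icost bound + 4)%N s' & I N s'.
  have [//|s' rs' IN] := loop N 0%N (set_int x 0 s) _ I0.
  exists s' => //; apply: (@runs_leq _ _ _ _ _ (3 + _)%N); last first.
    exact: runs_seq (runs_straight E (c := ISet (INum x) (INum 0)) s isT) rs'.
  by rewrite /for_cost; lia.
elim: j m s0 => [|j IH] m s0.
  rewrite addn0 => -> IN; have [xN bN] := Iout _ _ IN.
  exists s0 => //; exists (bcost (BLtI (IGet (INum x)) bound)).+1.
    by rewrite /=; lia.
  by apply: ExecWhileF; rewrite /= xN bN ltnn.
move=> mjN Im; have [xm bm] := Iout _ _ Im.
have [|s1 [k1 lek1 e1] I1] := step m s0 _ Im; first by lia.
have [|s' [k2 lek2 e2] IN] := IH m.+1 _ _ I1; first by lia.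
exists s' => //.
exists (bcost (BLtI (IGet (INum x)) bound) + (k1 + cost (incr x)) + k2).+1.
  by rewrite /=; lia.
apply: ExecWhileT e2; first by rewrite /= xm bm; lia.
apply: ExecSeq e1 _.
have -> : set_int x (imem s1 x).+1 s1 = run E (incr x) s1.
  by rewrite /set_int /= addn1.
exact: ExecISet.
Qed.

(** * The program *)

(** Integer memory: [n], [t], [i] in cells 0 to 2, the row in cell 3, the agent in
    cell 4.  Real memory: cells 0 and 1 hold the product of all [r_l] before and
    after the current row; for agent [l], the cells [2 + 2 l] and [3 + 2 l] hold
    [a] and [g] when her signal is known to satisfy [a < f <= 1 / g].  The initial
    contents [a = g = 0] of the memory then mean that nothing is known. *)
Definition lower_cell (l : iexp) : iexp := IAdd (INum 2) (IAdd l l).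
Definition upper_cell (l : iexp) : iexp := IAdd (INum 3) (IAdd l l).

(** The mass of [{a < f <= 1 / g}], as a difference of distribution functions of
    [ln f]; for [a = 0] and [g = 0] these are evaluated at the infinite points,
    because [lne 0 = -oo]. *)
Definition mass_exp (b : bool) (l : iexp) : rexp :=
  RSub (RCdf b (RSub (RNat (INum 0)) (RLn (RGet (upper_cell l)))))
       (RCdf b (RLn (RGet (lower_cell l)))).

Definition ratio_exp (l : iexp) : rexp :=
  RDiv (mass_exp true l) (mass_exp false l).

Definition raise (a : iexp) (e : rexp) : cmd :=
  If (BLtR (RGet a) e) (RSet a e) Skip.

Definition agent_body : cmd :=
  let k := IGet (INum 3) in
  let l := IGet (INum 4) in
  let th := RDiv (ratio_exp l) (RGet (INum 0)) in
  Seq (If (BLtI (INum 0) (IVote k l))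
          (raise (lower_cell l) th)
          (raise (upper_cell l) (RDiv (RNat (INum 1)) th)))
      (RSet (INum 1) (RMul (RGet (INum 1)) (ratio_exp l))).

Definition row_start : cmd :=
  Seq (RSet (INum 0) (RGet (INum 1))) (RSet (INum 1) (RNat (INum 1))).

Definition row_body : cmd :=
  Seq row_start (for_loop 4 (IGet (INum 0)) agent_body).

Definition answer : cmd :=
  If (BLtR (RLn (RDiv (ratio_exp (IGet (INum 2))) (RGet (INum 1)))) RSignal)
     (ISet (INum 0) (INum 1)) (ISet (INum 0) (INum 0)).

Definition vote_program : cmd :=
  Seq (RSet (INum 1) (RNat (INum 1)))
      (Seq (for_loop 3 (ISub (IGet (INum 1)) (INum 1)) row_body) answer).

(** * What the program computes *)

Section semantics_of_vote_program.
Context (R : realType) (E : env R) (n : nat).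

Definition agent_odds (I : \bar R * \bar R) : \bar R :=
  let mass b := env_cdf E b (0 - lne I.2) - env_cdf E b (lne I.1) in
  mass true / mass false.

Definition odds (I : nat -> \bar R * \bar R) : \bar R :=
  \prod_(l < n) agent_odds (I l).

Definition cutoff (I : nat -> \bar R * \bar R) (l : nat) : \bar R :=
  agent_odds (I l) / odds I.

(** A vote 1 says that [f] exceeds the threshold, a vote 0 that it does not; in the
    second case the reciprocal bound [g] increases. *)
Definition narrow (v : nat) (th : \bar R) (I : \bar R * \bar R) :=
  if (0 < v)%N then (Order.max I.1 th, I.2) else (I.1, Order.max I.2 (1 / th)).

Fixpoint bounds (k : nat) : nat -> \bar R * \bar R :=
  if k is k'.+1 then
    fun l => narrow (env_vote E k' l) (cutoff (bounds k') l) (bounds k' l)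
  else fun=> (0, 0).

Definition decision (t i : nat) : bool :=
  lne (cutoff (bounds t.-1) i) < env_signal E.

Definition holds_bounds (I : nat -> \bar R * \bar R) (s : state R) :=
  forall l, (l < n)%N ->
    rmem s (2 + (l + l))%N = (I l).1 /\ rmem s (3 + (l + l))%N = (I l).2.

(** After [m] agents of row [k]: the intervals of the agents below [m] are already
    those of row [k.+1], the thresholds still use the product of row [k]. *)
Definition agent_inv t i k (m : nat) (s : state R) :=
  [/\ [/\ imem s 0%N = n, imem s 1%N = t, imem s 2%N = i, imem s 3%N = k & imem s 4%N = m],
      rmem s 0%N = odds (bounds k),
      rmem s 1%N = \prod_(l < m) agent_odds (bounds k.+1 l)
    & holds_bounds (fun l => bounds (if (l < m)%N then k.+1 else k) l) s].

Definition row_inv t i (k : nat) (s : state R) :=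
  [/\ [/\ imem s 0%N = n, imem s 1%N = t, imem s 2%N = i & imem s 3%N = k],
      rmem s 1%N = odds (bounds k) & holds_bounds (bounds k) s].

Lemma reval_ratio_exp (s : state R) (l : iexp) (I : nat -> \bar R * \bar R) :
  holds_bounds I s -> (ieval E s l < n)%N ->
  reval E s (ratio_exp l) = agent_odds (I (ieval E s l)).
Proof. by move=> B /B[/= -> ->]. Qed.

Lemma run_raise (s : state R) (a : iexp) (e : rexp) :
  imem (run E (raise a e) s) = imem s /\
  forall b, rmem (run E (raise a e) s) b =
    if b == ieval E s a then Order.max (rmem s b) (reval E s e) else rmem s b.
Proof.
rewrite /=; case: ifPn => /= ae; split=> // b; rewrite ?/upd;
  by case: eqP => // ->; rewrite /Order.max ?ae ?(negbTE ae).
Qed.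

Lemma agent_step t i k m s : (m < n)%N -> agent_inv t i k m s ->
  exists2 s', runs E agent_body s (cost agent_body) s' &
              agent_inv t i k m.+1 (set_int 4 (imem s' 4%N).+1 s').
Proof.
move=> mn [[s0 s1 s2 s3 s4] Q Q' B].
have rE l : ieval E s l = m ->
    reval E s (ratio_exp l) = agent_odds (bounds k m).
  by move=> lE; rewrite (reval_ratio_exp B) lE ?ltnn.
pose l := IGet (INum 4); pose th := RDiv (ratio_exp l) (RGet (INum 0)).
have lE : ieval E s l = m by [].
have thE : reval E s th = cutoff (bounds k) m.
  by rewrite [reval _ _ _]/(reval E s (ratio_exp l) / rmem s 0%N) rE// Q.
pose c := If (BLtI (INum 0) (IVote (IGet (INum 3)) l))
  (raise (lower_cell l) th) (raise (upper_cell l) (RDiv (RNat (INum 1)) th)).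
have [mc [c0 c1 cB]] : imem (run E c s) = imem s /\
  [/\ rmem (run E c s) 0%N = rmem s 0%N, rmem (run E c s) 1%N = rmem s 1%N &
   holds_bounds (fun l => bounds (if (l < m.+1)%N then k.+1 else k) l)
     (run E c s)].
  have boundsE l' : bounds (if (l' < m.+1)%N then k.+1 else k) l' =
     if l' == m then narrow (env_vote E k m) (cutoff (bounds k) m) (bounds k m)
     else bounds (if (l' < m)%N then k.+1 else k) l'.
    case: eqP => [->|/eqP lm]; first by rewrite ltnSn.
    by congr (bounds (if _ then _ else _) _); lia.
  have -> : run E c s = if (0 < env_vote E (imem s 3%N) (imem s 4%N))%N
    then run E (raise (lower_cell l) th) s
    else run E (raise (upper_cell l) (RDiv (RNat (INum 1)) th)) s by [].
  rewrite s3 s4; case: ifPn => v.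
    have [-> rm] := run_raise s (lower_cell l) th.
    split=> //; split; [by rewrite rm|by rewrite rm|].
    move=> l' l'n; rewrite !rm thE boundsE /= s4 /narrow v.
    have [Ba Bg] := B _ l'n.
    (* the cells of distinct agents, and the two cells of one agent, differ *)
    have -> : (2 + (l' + l') == 2 + (m + m))%N = (l' == m) by lia.
    have -> : (3 + (l' + l') == 2 + (m + m))%N = false by lia.
    by case: eqP Ba Bg => // -> -> ->; rewrite ltnn.
  have [-> rm] := run_raise s (upper_cell l) (RDiv (RNat (INum 1)) th).
  split=> //; split; [by rewrite rm|by rewrite rm|].
  have th'E : reval E s (RDiv (RNat (INum 1)) th) = 1 / cutoff (bounds k) m.
    by rewrite -thE.
  move=> l' l'n; rewrite !rm th'E boundsE /= s4 /narrow (negbTE v).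
  have [Ba Bg] := B _ l'n.
  have -> : (3 + (l' + l') == 3 + (m + m))%N = (l' == m) by lia.
  have -> : (2 + (l' + l') == 3 + (m + m))%N = false by lia.
  by case: eqP Ba Bg => // -> -> ->; rewrite ltnn.
exists (run E (RSet (INum 1) (RMul (RGet (INum 1)) (ratio_exp l))) (run E c s)).
  exact: (runs_straight E (c := agent_body) s isT).
have rE' : reval E (run E c s) (ratio_exp l) = agent_odds (bounds k.+1 m).
  have lE' : ieval E (run E c s) l = m by rewrite -[LHS]/(imem _ 4%N) mc.
  by rewrite (reval_ratio_exp cB) lE' ?ltnSn.
move: (run E c s) mc c0 c1 cB rE' => s' mc c0 c1 cB rE'; split.
- by rewrite /set_int /= mc /upd /= s0 s1 s2 s3 s4.
- exact: etrans c0 Q.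
- have -> : rmem (set_int 4 (imem s' 4).+1
      (run E (RSet (INum 1) (RMul (RGet (INum 1)) (ratio_exp l))) s')) 1%N =
    rmem s' 1%N * reval E s' (ratio_exp l) by [].
  by rewrite rE' c1 Q' big_ord_recr.
- by rewrite /set_int /= mc s4; exact: cB.
Qed.

Lemma row_step t i k s : row_inv t i k s ->
  exists2 s', runs E row_body s
      (cost row_start + for_cost n (cost agent_body) 2) s' &
    row_inv t i k.+1 (set_int 3 (imem s' 3%N).+1 s').
Proof.
move=> [[s0 s1 s2 s3] Q B].
have [||m s' Is|s' rs' [[r0 r1 r2 r3 r4] _ rQ rB]] :=
    @runs_for_loop _ E 4 (IGet (INum 0)) agent_body n (cost agent_body)
    (agent_inv t i k) (run E row_start s).
- split=> //=; first by rewrite big_ord0.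
- by move=> m s' [[s'0 _ _ _ s'4] _ _ _].
- exact: agent_step.
exists s'; first exact: runs_seq (runs_straight E (c := row_start) s isT) rs'.
split; first by rewrite /set_int /= /upd /= r0 r1 r2 r3.
  exact: rQ.
by move=> l ln; have := rB l ln; rewrite ln.
Qed.

Lemma answerE t i k s : (i < n)%N -> row_inv t i k s ->
  imem (run E answer s) 0%N =
  (lne (cutoff (bounds k) i) < env_signal E) :> nat.
Proof.
move=> ilt [[_ _ s2 _] Q B].
have rE : reval E s (ratio_exp (IGet (INum 2))) = agent_odds (bounds k i).
  by rewrite (reval_ratio_exp B) /= s2.
have -> : run E answer s =
    if lne (reval E s (ratio_exp (IGet (INum 2))) / rmem s 1%N) < env_signal E
    then set_int 0 1 s else set_int 0 0 s by [].
by rewrite rE Q; case: ifP.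
Qed.

(** The constants 2 and 4 are the costs of the bounds of the two loops, the
    leading 4 that of the initial assignment. *)
Definition program_cost (t : nat) : nat :=
  (4 + (for_cost t.-1 (cost row_start + for_cost n (cost agent_body) 2) 4
        + cost answer))%N.

(** The program starts with the product 1 instead of computing it; this is right
    because unconstrained signals have mass 1 in both states. *)
Lemma odds0 : (forall b, env_cdf E b +oo = 1) ->
  (forall b, env_cdf E b -oo = 0) -> odds (bounds 0) = 1.
Proof.
move=> Fy FNy; rewrite /odds big1// => l _.
have -> : agent_odds (bounds 0 l) =
    (env_cdf E true (0 - lne 0) - env_cdf E true (lne 0)) /
    (env_cdf E false (0 - lne 0) - env_cdf E false (lne 0)) by [].
by rewrite le0_lneNy// sub0e [- -oo]/= !Fy !FNy !sube0 inve1 mule1.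
Qed.

Lemma vote_program_correct t i : (forall b, env_cdf E b +oo = 1) ->
  (forall b, env_cdf E b -oo = 0) -> (i < n)%N ->
  exists2 s', runs E vote_program (input_state R n t i) (program_cost t) s' &
    imem s' 0%N = decision t i.
Proof.
move=> Fy FNy ilt.
set c0 := RSet (INum 1) (RNat (INum 1)).
pose s0 := run E c0 (input_state R n t i).
have [||k s' ks Is|s' rs' Is'] :=
    @runs_for_loop _ E 3 (ISub (IGet (INum 1)) (INum 1)) row_body t.-1
    (cost row_start + for_cost n (cost agent_body) 2)
    (row_inv t i) s0.
- by split=> //; rewrite odds0.
- move=> k s' [[s'0 s'1 _ s'3] _ _]; split=> //.
  by rewrite -subn1 -s'1.
- exact: row_step.
exists (run E answer s'); last by rewrite (answerE ilt Is').
exact: (runs_seq (runs_straight E (c := c0) _ isT)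
                 (runs_seq rs' (runs_straight E (c := answer) s' isT))).
Qed.

End semantics_of_vote_program.

(** The parts of the program are run 1, [t.-1] or [n * t.-1] times, hence at most
    [n * t] times each, so that their costs may be added up. *)
Definition program_constant : nat :=
  cost answer + cost row_start + cost agent_body + 50.

Lemma program_cost_linear n t : (0 < n)%N -> (0 < t)%N ->
  (program_cost n t <= program_constant * (n * t))%N.
Proof.
rewrite /program_cost /program_constant /for_cost.
case: t n => [|t] [|n] // _ _ /=.
move: (cost answer) (cost row_start) (cost agent_body) => A S B; nia.
Qed.

(** * Null sets, integrals and thresholds *)

Lemma ae_measure_eq d (T : measurableType d) (R : realType)
    (m : {measure set T -> \bar R}) (A B : set T) :
  measurable A -> measurable B -> {ae m, forall x, A x <-> B x} -> m A = m B.
Proof.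
move=> mA mB [N [mN N0 ABN]].
have le (C D : set T) : measurable C -> measurable D ->
    (forall x, C x -> ~ D x -> N x) -> m C <= m D.
  move=> mC mD CDN; apply: (@le_trans _ _ (m (D `|` N))).
    rewrite le_measure ?inE//; first exact: measurableU.
    by move=> x Cx; have [Dx|Dx] := pselect (D x); [left|right; exact: CDN].
  by rewrite measureU0.
apply/eqP; rewrite eq_le !le// => x Ax Bx; apply: ABN => /=; tauto.
Qed.

Section integral_threshold.
Context d (X : measurableType d) (R : realType) (m : probability X R).
Variables (g : X -> R) (A : set X) (k : R).
Hypotheses (ig : m.-integrable setT (EFin \o g)) (mA : measurable A).

Let igA : m.-integrable A (EFin \o g).
Proof. exact: integrableS ig. Qed.

Lemma integral_le_threshold : (forall x, A x -> (g x <= k)%R) ->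
  \int[m]_(x in A) (g x)%:E <= k%:E * m A.
Proof.
move=> gk; rewrite -integral_cst//; apply: le_integral => //.
  exact: finite_measure_integrable_cst.
by move=> x /set_mem Ax; rewrite lee_fin gk.
Qed.

(** Together with [integral_le_threshold], the tool by which a comparison of
    integrals shows that an event is null; it is used for the conditional
    probabilities, with [k = 1/2], and for the density [f]. *)
Lemma integral_gt_threshold_null : (forall x, A x -> (k < g x)%R) ->
  \int[m]_(x in A) (g x)%:E <= k%:E * m A -> m A = 0.
Proof.
move=> gk le; have ik := finite_measure_integrable_cst m k mA.
have int0 : \int[m]_(x in A) `|(g x - k)%:E| = 0.
  apply/eqP; rewrite eq_le integral_ge0// andbT.
  rewrite (eq_integral (fun x => (EFin \o g) x - (EFin \o cst k) x)); last first.
    move=> x /set_mem Ax; rewrite /= -EFinB ger0_norm//.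
    by rewrite subr_ge0 ltW// gk.
  rewrite integralB// -[EFin \o cst k]/(cst k%:E) integral_cst//.
  by rewrite sube_le0.
have mg : measurable_fun A (fun x => (g x - k)%:E).
  by have := integrableB mA igA ik; case/integrableP.
have [N [mN N0 AN]] := (ae_eq_integral_abs m mA mg).1 int0.
apply: (subset_measure0 mA mN _ N0) => x Ax; apply: AN => /= /(_ Ax)/eqP.
by rewrite eqe subr_eq0 gt_eqF ?gk.
Qed.

End integral_threshold.

(** * The density of the signals *)

Section likelihood.
Context d (Om : measurableType d) (R : realType).
Variables (mu0 mu1 : probability Om R) (f : {mfun Om >-> R}).
Hypothesis fP : signal_model mu0 mu1 f.

Lemma signal_null A : measurable A -> (mu0 A == 0) = (mu1 A == 0).
Proof.
have [/null_content_dominatesP m01 /null_content_dominatesP m10 _ _ _] := fP.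
by move=> mA; apply/eqP/eqP => [/m10|/m01]; exact.
Qed.

Let dom : charge_of_finite_measure mu1 `<< mu0.
Proof. by have [] := fP. Qed.

Let mf : measurable_fun setT (EFin \o f).
Proof. by apply/measurable_EFinP; exact: measurable_funP. Qed.

Lemma density_integrable : mu0.-integrable setT (EFin \o f).
Proof.
have [_ _ RNf _ _] := fP.
apply/integrableP; split=> //.
have /integrableP[mRN] := Radon_Nikodym_integrable dom.
rewrite (ae_eq_integral (abse \o (EFin \o f)))//.
- exact: measurableT_comp.
- exact: measurableT_comp.
- exact: ae_eq_abse.
Qed.

Lemma density_integral A : measurable A ->
  mu1 A = \int[mu0]_(x in A) (f x)%:E.
Proof.
move=> mA; have [_ _ RNf _ _] := fP.
rewrite -[LHS]/(charge_of_finite_measure mu1 A) (Radon_Nikodym_integral dom mA).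
have /integrableP[mRN _] := Radon_Nikodym_integrable dom.
apply: ae_eq_integral => //.
- exact: measurable_funS mRN.
- exact: measurable_funS mf.
- exact: ae_eq_subset RNf.
Qed.

(** The numbers [c0] and [c1] stand for the probabilities of the votes of the other
    agents in the two states: below the threshold [c0 / c1], the state 0 is at
    least as likely. *)
Lemma likelihood_le (A : set Om) (c0 c1 : R) : measurable A ->
  (0 <= c0)%R -> (0 <= c1)%R ->
  (forall w, A w -> (f w <= c0 / c1)%R) -> mu1 A * c1%:E <= mu0 A * c0%:E.
Proof.
move=> mA c00 c10 Af.
have [->|c1n0] := eqVneq c1 0%R; first by rewrite mule0 mule_ge0.
rewrite density_integral//.
apply: (@le_trans _ _ ((c0 / c1)%:E * mu0 A * c1%:E)).
  apply: lee_wpmul2r; first by rewrite lee_fin.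
  exact: integral_le_threshold density_integrable _ _.
by rewrite muleAC -EFinM divfK// muleC.
Qed.

(** Above the threshold the state 1 is strictly more likely, except on null
    sets. *)
Lemma likelihood_gt_null (A : set Om) (c0 c1 : R) : measurable A ->
  (0 < c1)%R ->
  (forall w, A w -> (c0 / c1 < f w)%R) -> mu1 A * c1%:E <= mu0 A * c0%:E ->
  mu0 A = 0.
Proof.
move=> mA c10 Af le.
apply: (@integral_gt_threshold_null _ _ _ mu0 f A (c0 / c1)) => //.
  exact: density_integrable.
rewrite -density_integral// EFinM muleAC [c0%:E * _]muleC.
by rewrite lee_pdivlMr.
Qed.

End likelihood.

(** * The signals compatible with a table of votes *)

Section cells.
Context d (Om : measurableType d) (R : realType).
Variables (mu0 mu1 : probability Om R) (f : {mfun Om >-> R}) (n : nat).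
Implicit Types (I : 'I_n -> set Om) (u : nat -> 'I_n -> bool).

Definition others (mu : probability Om R) I (j : 'I_n) : R :=
  (\prod_(l < n | l != j) fine (mu (I l)))%R.

(** When the signal of each agent [l] is known to lie in [I l], agent [j] believes
    in the state 1 with probability more than 1/2 iff [f] exceeds this number at
    her signal. *)
Definition threshold I (j : 'I_n) : R := (others mu0 I j / others mu1 I j)%R.

(** The signals of agent [j] that lead to her votes in the rows of [u] below [k],
    when all agents vote according to the thresholds. *)
Fixpoint cell u (k : nat) : 'I_n -> set Om :=
  if k is k'.+1 then fun j => cell u k' j `&`
     [set w | (threshold (cell u k') j < f w)%R = u k' j]
  else fun=> setT.

Lemma cellP u k j w : cell u k j w <->
  forall k', (k' < k)%N -> (threshold (cell u k') j < f w)%R = u k' j.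
Proof.
elim: k => [|k IH] //=; split.
  move=> [/IH H1 H2] k'; rewrite ltnS leq_eqVlt => /predU1P[->//|].
  exact: H1.
by move=> H; split; [apply/IH => k' kk; apply: H; exact: ltnW|exact: H].
Qed.

Lemma eq_cell u v k : (forall k', (k' < k)%N -> u k' =1 v k') ->
  cell u k = cell v k.
Proof.
elim: k => [|k IH] //= uv; rewrite IH => [|k' /ltnW]; last exact: uv.
by apply/funext => j; rewrite uv.
Qed.

Lemma measurable_cell u k j : measurable (cell u k j).
Proof.
elim: k => [|k IH] //=; apply: measurableI => //.
rewrite -[X in measurable X]setTI.
have mf : measurable_fun setT (fun w => threshold (cell u k) j < f w)%R.
  by apply: measurable_fun_ltr => //; exact: measurable_funP.
exact: (mf measurableT [set u k j]).
Qed.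

Lemma others_ge0 mu I j : (0 <= others mu I j)%R.
Proof. by apply: prodr_ge0 => l _; exact: fine_ge0. Qed.

Lemma othersE (mu : probability Om R) I j : (forall l, measurable (I l)) ->
  \prod_(l < n | l != j) mu (I l) = (others mu I j)%:E.
Proof.
move=> mI; rewrite -prodEFin; apply: eq_bigr => l _.
by rewrite fineK// fin_num_measure.
Qed.

End cells.

(** * Votes follow the thresholds *)

Section voters.
Context d (Om : measurableType d) (R : realType).
Variables (mu0 mu1 : probability Om R) (f : {mfun Om >-> R}) (n : nat).
Hypothesis fP : signal_model mu0 mu1 f.
Context d' (T : measurableType d') (P : probability T R).
Variables (S : {mfun T >-> bool}) (W : 'I_n -> {mfun T >-> Om}).
Variable V : nat -> 'I_n -> T -> bool.
Hypotheses (law : has_joint_law P S W mu0 mu1) (VP : is_vote_process P S W V).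
Implicit Types (u : nat -> 'I_n -> bool) (i j : 'I_n).

Local Notation cell := (cell mu0 mu1 f).
Local Notation threshold := (threshold mu0 mu1).

(** The votes as a table whose row [k] holds the time [k + 1]. *)
Definition votes (e : T) (k : nat) (j : 'I_n) : bool := V k.+1 j e.

Definition table m (h : 'M[bool]_(m, n)) (k : nat) (j : 'I_n) : bool :=
  if insub k is Some k' then h k' j else false.

Lemma table_history m e k : (k < m)%N ->
  votes e k =1 table (history V m.+1 e) k.
Proof. by move=> km j; rewrite /table insubT mxE. Qed.

Definition rational_at (k : nat) (e : T) : Prop :=
  forall j, V k.+1 j e = (threshold (cell (votes e) k) j < f (W j e))%R.

Definition same_votes u (m : nat) : set T :=
  [set e | forall k, (k < m)%N -> votes e k =1 u k].

(** A history determines a rectangle of signals.  In the converse direction, the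
    rows are recovered one after the other, since the thresholds of a row depend
    on the previous rows only. *)
Lemma same_votes_cell u m e : (forall k, (k < m)%N -> rational_at k e) ->
  same_votes u m e <-> forall j, cell u m j (W j e).
Proof.
move=> rat; split=> [same j|inc k].
  apply/cellP => k km; rewrite -(same k km) /votes (rat k km).
  have cE : cell (votes e) k = cell u k.
    by apply: eq_cell => l lk; exact: (same l (ltn_trans lk km)).
  by rewrite cE.
elim/ltn_ind: k => k IH km j; rewrite /votes (rat k km).
have -> : cell (votes e) k = cell u k.
  by apply: eq_cell => l lk; exact: (IH l lk (ltn_trans lk km)).
by have /cellP := inc j; apply.
Qed.

(** Votes are random variables: by induction on time, since a vote compares a
    function measurable for the information at that time with a constant. *)
Lemma info_sub_measurable i t :
  info W V i t `<=` measurable /\ ((0 < t)%N -> measurable_fun setT (V t i)).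
Proof.
elim/ltn_ind: t i => t IH i.
have infoM : info W V i t `<=` measurable.
  apply: smallest_sub; first exact: sigma_algebra_measurable.
  move=> A [|[k /= /andP[k0 kt]] [j _]].
    by move=> [B mB <-]; exact: (measurable_funP (W i)).
  by move=> [B mB <-]; have [_ /(_ k0)] := IH k kt j; exact.
split=> // t0; have [p [pG _ _] Vp] := VP i t0.
have -> : V t i = (fun w => 2^-1 < p w)%R by apply/funext.
have mp : measurable_fun setT p.
  by move=> _ B mB; rewrite setTI; apply: infoM; exact: pG.
exact: measurable_fun_ltr.
Qed.

Lemma info_same_votes i u m : info W V i m.+1 (same_votes u m).
Proof.
rewrite /info; set GG := (X in <<s X>>).
have -> : same_votes u m = \bigcap_(k in [set k | (k < m)%N])
    \bigcap_(j in [set: 'I_n]) (V k.+1 j @^-1` [set u k j]).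
  apply/seteqP; split=> [e same k km j _|e same k km j]; first exact: same.
  exact: same.
rewrite -[_ (\bigcap_(k in _) _)]/(measurable (_ : set (g_sigma_algebraType GG))).
apply: fin_bigcap_measurable => [|k /= km]; first exact: finite_II.
apply: fin_bigcap_measurable => // j _.
apply: sub_sigma_algebra; right; exists k.+1 => //; exists j => //.
by exists [set u k j] => //; rewrite setTI.
Qed.

(** Once the public history is known, agent [i] knows only her signal: the
    sets with this property form a sigma-algebra that contains the generators. *)
Lemma info_trace i u m A : info W V i m.+1 A -> exists2 B, measurable B &
  forall e, same_votes u m e -> A e <-> B (W i e).
Proof.
move: A; apply: smallest_sub; last first.
  move=> A [|[k /= /andP[k0 km]] [j _]] [B mB <-].
    by exists B => // e _; split=> [[]|].
  case: k k0 km => // k _ km.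
  have [Bu|Bu] := pselect (B (u k j)); [exists setT|exists set0] => // e same;
    rewrite setTI /preimage/=; have := same k km j; rewrite /votes => ->; by [].
split.
- by exists set0.
- move=> A [B mB AB]; exists (~` B) => [|e /AB ABe]; first exact: measurableC.
  by rewrite setTD /setC /= ABe.
- move=> A trA.
  have /choice[B BP] : forall k, exists B, measurable B /\
      forall e, same_votes u m e -> A k e <-> B (W i e).
    by move=> k; have [B mB BA] := trA k; exists B.
  exists (\bigcup_k B k) => [|e same].
    by apply: bigcupT_measurable => k; have [] := BP k.
  by split=> -[k _ kE]; exists k => //; apply/(BP k).2.
Qed.

Definition signal_law (b : bool) := if b then mu1 else mu0.

(** Up to a null set the event is a rectangle in the signals, to which the product
    form of the joint law applies; the factor of agent [i] is set apart. *)
Lemma law_same_votes i u m (b : bool) A :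
  {ae P, forall e k, (k < m)%N -> rational_at k e} -> measurable A ->
  P (S @^-1` [set b] `&` (W i @^-1` A `&` same_votes u m)) =
  (2^-1)%:E * (signal_law b (A `&` cell u m i) *
               (others (signal_law b) (cell u m) i)%:E).
Proof.
move=> rat mA.
pose B j := if j == i then A `&` cell u m i else cell u m j.
have mB j : measurable (B j).
  by rewrite /B; case: ifP => _; [apply: measurableI => //|];
    exact: measurable_cell.
have mW j C : measurable C -> measurable (W j @^-1` C).
  by move=> mC; exact: measurable_funPTI.
have mS : measurable (S @^-1` [set b]).
  exact: measurable_funPTI.
have -> : P (S @^-1` [set b] `&` (W i @^-1` A `&` same_votes u m)) =
    P (S @^-1` [set b] `&` \bigcap_(j in [set: 'I_n]) (W j @^-1` B j)).
  apply: ae_measure_eq.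
  - apply: measurableI => //; apply: measurableI; first exact: mW.
    by have [sub _] := info_sub_measurable i m.+1; apply: sub; exact: info_same_votes.
  - apply: measurableI => //; apply: fin_bigcap_measurable => // j _.
    exact/mW/mB.
  - apply: filterS rat => e rat /=; apply: and_iff_compat_l.
    rewrite (same_votes_cell _ (rat)); split.
      move=> [Ai inc] j _ /=; rewrite /B.
      by case: eqP => [->|_]; [split|].
    move=> BW; have := BW i I; rewrite /B /= eqxx => -[Ai ci]; split=> // j.
    by have := BW j I; rewrite /B /=; case: eqP => [->|].
rewrite law//.
have prodB (mu : probability Om R) : \prod_(j < n) mu (B j) =
    mu (A `&` cell u m i) * (others mu (cell u m) i)%:E :> \bar R.
  rewrite (bigD1 i)//= {1}/B eqxx -othersE; last exact: measurable_cell.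
  by congr (_ * _); apply: eq_bigr => j /negbTE ji; rewrite /B ji.
have iE (x : bool) : (x \in [set b]) = (x == b).
  by apply/idP/eqP; rewrite inE.
rewrite !prodB !diracE !iE; case: b {mS iE} => /=.
  by rewrite mul0e mule0 add0e mul1e.
by rewrite mul0e mule0 adde0 mul1e.
Qed.

Lemma prob_same_votes i u m A (E := W i @^-1` A `&` same_votes u m) :
  {ae P, forall e k, (k < m)%N -> rational_at k e} -> measurable A ->
  P E = (2^-1)%:E * (mu0 (A `&` cell u m i) * (others mu0 (cell u m) i)%:E) +
        (2^-1)%:E * (mu1 (A `&` cell u m i) * (others mu1 (cell u m) i)%:E).
Proof.
move=> rat mA; have mE : measurable E.
  apply: measurableI.
    exact: measurable_funPTI.
  by have [sub _] := info_sub_measurable i m.+1; apply: sub; exact: info_same_votes.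
have mS b : measurable (S @^-1` [set b]).
  exact: measurable_funPTI.
rewrite -(law_same_votes i u false)// -(law_same_votes i u true)//.
rewrite -measureU//; [|exact: measurableI|exact: measurableI|].
  congr (P _); apply/seteqP; split=> [e Ee|e [[]|[]]//].
  by case: (boolP (S e)) => Se; [right|left]; split => //=; exact/negbTE.
by apply/seteqP; split => // e [[/= -> _] [/=]].
Qed.

(** Bayes' rule with a uniform prior: the state 1 has conditional probability at
    most 1/2 iff its likelihood does not exceed that of the state 0. *)
Lemma half_posterior_same_votes i u m A (E := W i @^-1` A `&` same_votes u m) :
  {ae P, forall e k, (k < m)%N -> rational_at k e} -> measurable A ->
  (P (E `&` S @^-1` [set true]) <= (2^-1)%:E * P E) =
  (mu1 (A `&` cell u m i) * (others mu1 (cell u m) i)%:E <=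
   mu0 (A `&` cell u m i) * (others mu0 (cell u m) i)%:E).
Proof.
move=> rat mA; have mC := measurable_cell mu0 mu1 f u m i.
rewrite setIC prob_same_votes// law_same_votes// /signal_law.
rewrite -[mu1 _]fineK ?fin_num_measure//; last exact: measurableI.
rewrite -[mu0 _]fineK ?fin_num_measure//; last exact: measurableI.
by rewrite -!EFinM !lee_fin; apply/idP/idP; lra.
Qed.

Lemma others_eq0 u m i : others mu1 (cell u m) i = 0%R ->
  others mu0 (cell u m) i = 0%R.
Proof.
move=> /eqP/prodf_eq0[l li mu1l0]; apply/eqP/prodf_eq0; exists l => //.
have mC := measurable_cell mu0 mu1 f u m l.
rewrite -eqe fineK ?fin_num_measure// (signal_null fP)//.
by rewrite -[mu1 _]fineK ?fin_num_measure// eqe.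
Qed.

(** The conditional probability [p] and the threshold rule can disagree only on
    [E true] and [E false], which belong to the information of agent [i].  On
    each of them one of [p] and the likelihood ratio is on the weak side of its
    bound, which gives an inequality between integrals, and the other is on the
    strict side, which turns it into nullity. *)
Lemma vote_of_same_votes i u m :
  {ae P, forall e k, (k < m)%N -> rational_at k e} ->
  {ae P, forall e, same_votes u m e ->
    V m.+1 i e = (threshold (cell u m) i < f (W i e))%R}.
Proof.
move=> rat; have [p [pG ip intp] Vp] := VP i (ltn0Sn m).
set c := threshold (cell u m) i.
have mC := measurable_cell mu0 mu1 f u m i.
have c0ge := others_ge0 mu0 (cell u m) i.
have c1ge := others_ge0 mu1 (cell u m) i.
have mf : measurable_fun setT f by exact: measurable_funP.
have GI A B : info W V i m.+1 A -> info W V i m.+1 B ->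
    info W V i m.+1 (A `&` B).
  rewrite /info; set GG := (X in <<s X>>).
  exact: (@measurableI _ (g_sigma_algebraType GG)).
pose D b := [set w | (c < f w)%R = b].
have mD b : measurable (D b).
  rewrite -[X in measurable X]setTI.
  have mlt : measurable_fun setT (fun w => c < f w)%R.
    exact: measurable_fun_ltr.
  exact: (mlt measurableT [set b]).
pose E b := [set e | (2^-1 < p e)%R = b] `&`
            (W i @^-1` D (~~ b) `&` same_votes u m).
have GE b : info W V i m.+1 (E b).
  apply: (GI).
    apply: (pG [set x | (2^-1 < x)%R = b]).
    rewrite -[X in measurable X]setTI.
    have mlt : measurable_fun setT (fun x : R => 2^-1 < x)%R.
      exact: measurable_fun_ltr.
    exact: (mlt measurableT [set b]).
  apply: GI; last exact: info_same_votes.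
  apply: sub_sigma_algebra; left; exists (D (~~ b)) => //.
  by rewrite setTI.
have mE b : measurable (E b).
  by have [sub _] := info_sub_measurable i m.+1; exact: sub.
have EE b : exists2 A, measurable A /\ A `<=` D (~~ b) &
    E b = W i @^-1` A `&` same_votes u m.
  have [A mA EA] := info_trace u (GE b).
  exists (A `&` D (~~ b)); first by split; [exact: measurableI|move=> w []].
  apply/seteqP; split=> [e Ee|e [[/= Ae De] se]].
    have [_ [De se]] := Ee; split=> //; split=> //.
    by apply/(EA e se).
  exact/(EA e se).
have Etrue0 : P (E true) = 0.
  have [A [mA AD] EA] := EE true.
  apply: (@integral_gt_threshold_null _ _ _ P p (E true) 2^-1) => //.
    by move=> e [].
  rewrite intp// EA half_posterior_same_votes//.
  apply: (likelihood_le fP) => //; first exact: measurableI.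
  by move=> w [/AD/= /negbT]; rewrite -leNgt.
have Efalse0 : P (E false) = 0.
  have [A [mA AD] EA] := EE false.
  have mAC := measurableI _ _ mA mC.
  have : \int[P]_(w in E false) (p w)%:E <= (2^-1)%:E * P (E false).
    apply: integral_le_threshold => // e [/= /negbT].
    by rewrite -leNgt.
  rewrite intp// EA half_posterior_same_votes// prob_same_votes// => le.
  (* if [u] is impossible for the others in one state, it is so in both *)
  have [c10|c1n0] := eqVneq (others mu1 (cell u m) i) 0%R.
    by rewrite c10 (others_eq0 c10) !mule0 adde0.
  have mu00 : mu0 (A `&` cell u m i) = 0.
    apply: (likelihood_gt_null fP) le => //; first by rewrite lt_def c1n0.
    by move=> w [/AD].
  have -> : mu1 (A `&` cell u m i) = 0.
    by apply/eqP; rewrite -(signal_null fP)// mu00.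
  by rewrite mu00 !mul0e !mule0 adde0.
have ae b : P (E b) = 0 -> {ae P, forall e, ~ E b e}.
  by move=> Eb0; exists (E b); split=> // e /= /contrapT.
apply: filterS2 (ae true Etrue0) (ae false Efalse0) => e nEt nEf se.
rewrite Vp; case: (boolP (2^-1 < p e)%R) => pe.
  by case: (boolP (c < f (W i e))%R) => // ce; case: nEt; split=> //=;
    split=> //; exact/negbTE.
case: (boolP (c < f (W i e))%R) => // ce; case: nEf; split=> //=.
exact/negbTE.
Qed.

(** There are finitely many histories of a given length, so the exceptional null
    sets of the single histories can be united. *)
Lemma vote_rational m : {ae P, forall e, rational_at m e}.
Proof.
elim/ltn_ind: m => m IH.
have rat : {ae P, forall e k, (k < m)%N -> rational_at k e}.
  apply: ae_foralln => k; case: (ltnP k m) => [/IH|_]; last exact: aeW.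
  by apply: filterS => e.
have : {ae P, forall e (h : 'M[bool]_(m, n)) i, same_votes (table h) m e ->
    V m.+1 i e = (threshold (cell (table h) m) i < f (W i e))%R}.
  apply: filter_forall => h; apply: filter_forall => i.
  exact: vote_of_same_votes.
apply: filterS => e /(_ (history V m.+1 e)) eV i.
rewrite eV => [|k km]; last exact: table_history.
suff -> : cell (table (history V m.+1 e)) m = cell (votes e) m by [].
by apply: eq_cell => k km j; rewrite (table_history e km).
Qed.

(** In both states the mass of the cell of agent [l] is a factor of the
    probability of the history. *)
Lemma same_votes_pos u m l :
  {ae P, forall e, same_votes u m e -> mu0 (cell u m l) != 0}.
Proof.
have [cl0|] := eqVneq (mu0 (cell u m l)) 0; last by move=> c0; exact: aeW.
have rat : {ae P, forall e k, (k < m)%N -> rational_at k e}.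
  by apply: ae_foralln => k; apply: filterS (vote_rational k).
exists (W l @^-1` setT `&` same_votes u m); split.
- by have [sub _] := info_sub_measurable l m.+1; rewrite preimage_setT setTI;
    apply: sub; exact: info_same_votes.
- have cl1 : mu1 (cell u m l) = 0.
    by apply/eqP; rewrite -(signal_null fP) ?cl0//; exact: measurable_cell.
  by rewrite prob_same_votes// setTI cl0 cl1 !mul0e !mule0 adde0.
- by move=> e /= /not_implyP[same _]; split.
Qed.

End voters.

(** * The program evaluates the thresholds *)

Section oracle.
Context d (Om : measurableType d) (R : realType).
Variables (mu0 mu1 : probability Om R) (f : {mfun Om >-> R}) (n : nat).
Hypothesis fP : signal_model mu0 mu1 f.

Let f0 w : (0 < f w)%R. Proof. by have [_ _ _ + _] := fP; apply. Qed.

Let mf : measurable_fun setT f. Proof. exact: measurable_funP. Qed.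

Definition interval (a g : R) : set Om := [set w | (a < f w)%R /\ (f w * g <= 1)%R].

Local Notation F := (cdf_oracle mu0 mu1 f).
Local Notation mu := (signal_law mu0 mu1).

Lemma cdf_oracleE b (r : R) : F b r%:E = mu b [set w | (ln (f w) <= r)%R].
Proof.
by case: b; rewrite /= /cdf /distribution /pushforward; congr (_ _);
  apply/seteqP; split => w /=; rewrite in_itv.
Qed.

Lemma oracle_lower b (a : R) : (0 <= a)%R ->
  F b (lne a%:E) = mu b [set w | (f w <= a)%R].
Proof.
rewrite le0r => /predU1P[->|a0].
  rewrite le0_lneNy//= (_ : [set _ | _] = set0) ?measure0//.
  by apply/seteqP; split=> w //=; rewrite leNgt f0.
rewrite lne_EFin// cdf_oracleE; congr (mu b _); apply/seteqP.
by split=> w /=; rewrite ler_ln// posrE.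
Qed.

Lemma oracle_upper b (g : R) : (0 <= g)%R ->
  F b (0 - lne g%:E) = mu b [set w | (f w * g <= 1)%R].
Proof.
rewrite le0r => /predU1P[->|g0].
  rewrite le0_lneNy// sub0e /= (_ : [set _ | _] = setT).
    by case: b; rewrite probability_setT.
  by apply/seteqP; split=> w //=; rewrite mulr0.
rewrite lne_EFin// sub0e -EFinN cdf_oracleE; congr (mu b _); apply/seteqP.
split=> w /=; rewrite -lnV ?posrE// ler_ln ?posrE ?invr_gt0//;
  by rewrite -[(g^-1)%R]mul1r ler_pdivlMr.
Qed.

Let measurable_sublevel (c : R) : measurable [set w | (f w <= c)%R].
Proof.
have mle : measurable_fun setT (fun w => f w <= c)%R by exact: measurable_fun_ler.
by rewrite -[X in measurable X]setTI; exact: (mle measurableT [set true]).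
Qed.

Let measurable_upper (g : R) : measurable [set w | (f w * g <= 1)%R].
Proof.
have mle : measurable_fun setT (fun w => f w * g <= 1)%R.
  by apply: measurable_fun_ler => //; exact: measurable_funM.
by rewrite -[X in measurable X]setTI; exact: (mle measurableT [set true]).
Qed.

Let intervalE a g : interval a g =
  [set w | (f w * g <= 1)%R] `\` [set w | (f w <= a)%R].
Proof.
apply/seteqP; split=> w [/= ? ?]; split=> //.
  by apply/negP; rewrite -ltNge.
by rewrite ltNge; exact/negP.
Qed.

Lemma measurable_interval a g : measurable (interval a g).
Proof. by rewrite intervalE; exact: measurableD. Qed.

(** Nonemptiness gives [a < 1 / g]; for [a > 1 / g] the difference of distribution
    functions may be negative. *)
Lemma interval_mass b a g : (0 <= a)%R -> (0 <= g)%R -> interval a g !=set0 ->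
  F b (0 - lne g%:E) - F b (lne a%:E) = mu b (interval a g).
Proof.
move=> a0 g0 [w0 [aw0 w0g]]; rewrite oracle_lower// oracle_upper//.
have LU : [set w | (f w <= a)%R] `<=` [set w | (f w * g <= 1)%R].
  move=> w /= wa; apply: le_trans w0g; rewrite ler_wpM2r//.
  by rewrite (le_trans wa)// ltW.
by rewrite intervalE measureD ?ltey_eq ?fin_num_measure// setIidr.
Qed.

Variable E : env R.
Hypothesis EF : env_cdf E = F.

Lemma ratio_interval a g : (0 <= a)%R -> (0 <= g)%R -> mu0 (interval a g) != 0 ->
  agent_odds E (a%:E, g%:E) =
    (fine (mu1 (interval a g)) / fine (mu0 (interval a g)))%:E.
Proof.
move=> a0 g0 I0; have mI := measurable_interval a g.
have In0 : interval a g !=set0.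
  by apply/set0P; apply: contra_neq I0 => ->; rewrite measure0.
rewrite /agent_odds EF [(_, _).1]/= [(_, _).2]/= !interval_mass//=.
rewrite -[X in X / _]fineK ?fin_num_measure// -[X in _ / X]fineK ?fin_num_measure//.
by rewrite inver fine_eq0 ?fin_num_measure// (negbTE I0).
Qed.

Variables (u : nat -> 'I_n -> bool) (m : nat).
Hypothesis Eu : forall k (l : 'I_n), (k < m)%N -> env_vote E k l = u k l.

Local Notation cell := (cell mu0 mu1 f u).
Local Notation bounds := (bounds E n).

(** The stored numbers are finite and describe the cells. *)
Definition tracked k := forall l : 'I_n, exists a g,
  [/\ (0 <= a)%R, (0 <= g)%R, bounds k l = (a%:E, g%:E) &
      cell k l = interval a g].

(** Dividing the factor of agent [l] out of the full product leaves the product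
    over the others; positive masses make this exact in the extended reals. *)
Lemma cutoffE k (l : 'I_n) : (forall j, mu0 (cell k j) != 0) -> tracked k ->
  cutoff E n (bounds k) l = (threshold mu0 mu1 (cell k) l)%:E /\
  (0 < threshold mu0 mu1 (cell k) l)%R.
Proof.
move=> pos tr; pose m0 j := fine (mu0 (cell k j)); pose m1 j := fine (mu1 (cell k j)).
have mC j := measurable_cell mu0 mu1 f u k j.
have m0n j : m0 j != 0%R by rewrite fine_eq0 ?fin_num_measure//.
have m1n j : m1 j != 0%R.
  by rewrite fine_eq0 ?fin_num_measure// -(signal_null fP).
have rE (j : 'I_n) : agent_odds E (bounds k j) = (m1 j / m0 j)%:E.
  have [a [g [a0 g0 -> cE]]] := tr j.
  by rewrite ratio_interval// -cE ?pos.
have p0 : (0 < others mu0 (cell k) l)%R.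
  apply: prodr_gt0 => j _; rewrite lt_def m0n; exact: fine_ge0.
have p1 : (0 < others mu1 (cell k) l)%R.
  apply: prodr_gt0 => j _; rewrite lt_def m1n; exact: fine_ge0.
split; last by rewrite divr_gt0.
rewrite /cutoff rE /odds.
rewrite (eq_bigr (fun j : 'I_n => (m1 j / m0 j)%:E)) => [|j _]; last exact: rE.
rewrite prodEFin (bigD1 l)//= prodf_div -/(others mu0 _ _) -/(others mu1 _ _).
have n0 : (m1 l / m0 l *
    (others mu1 (cell k) l / others mu0 (cell k) l) != 0)%R.
  by rewrite !mulf_neq0 ?invr_neq0// gt_eqF.
rewrite inver (negbTE n0) -EFinM; congr EFin.
rewrite /threshold; field.
by rewrite m0n m1n !gt_eqF.
Qed.

Lemma cell_decreasing k j l : (k <= j)%N -> cell j l `<=` cell k l.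
Proof.
by move=> kj w /cellP H; apply/cellP => i ik; apply: H; exact: leq_trans kj.
Qed.

Lemma cell_pos k : (k <= m)%N -> (forall j, mu0 (cell m j) != 0) ->
  forall j, mu0 (cell k j) != 0.
Proof.
move=> km pos j; have mC i := measurable_cell mu0 mu1 f u i j.
apply: contra_neq (pos j) => z.
exact: (subset_measure0 (mC m) (mC k) (cell_decreasing km) z).
Qed.

(** Comparing [f] with a threshold cuts an interval into intervals.  Positivity is
    assumed for the last row only, since the cells decrease. *)
Lemma bounds_tracked k : (k <= m)%N -> (forall j, mu0 (cell m j) != 0) ->
  tracked k.
Proof.
move=> + pos; elim: k => [_ l|k IH km l].
  exists 0%R, 0%R; split=> //; apply/seteqP; split=> // w _.
  by split; rewrite ?mulr0.
have tr := IH (ltnW km); have [a [g [a0 g0 bE cE]]] := tr l.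
have [thE th0] := cutoffE l (cell_pos (ltnW km) pos) tr.
set th := threshold mu0 mu1 (cell k) l in thE th0.
have -> : cell k.+1 l = interval a g `&` [set w | (th < f w)%R = u k l].
  by rewrite -cE.
have -> : bounds k.+1 l = narrow (u k l) th%:E (a%:E, g%:E).
  by rewrite -bE -thE -Eu.
rewrite /narrow; case: (u k l) => /=.
  exists (Order.max a th), g; split=> //; first by rewrite le_max a0.
    by rewrite EFin_max.
  apply/seteqP; split=> w /=; rewrite /interval/= gt_max.
    by move=> [[-> ->] ->].
  by move=> [/andP[]].
exists a, (Order.max g th^-1)%R; split=> //; first by rewrite le_max g0.
  by rewrite EFin_max inver gt_eqF// -EFinM div1r.
apply/seteqP; split=> w /=; have fw := ltW (f0 w);
  rewrite /interval/= maxr_pMr// ge_max.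
  by move=> [[-> ->] /negbT]; rewrite -leNgt ler_pdivrMr// mul1r => ->.
move=> [-> /andP[-> ]]; rewrite ler_pdivrMr// mul1r leNgt => /negbTE.
by [].
Qed.

End oracle.

Theorem theorem1p7 (R : realType) (d : measure_display) (Om : measurableType d)
    (mu0 mu1 : probability Om R) (f : {mfun Om >-> R}) :
  signal_model mu0 mu1 f ->
  exists (c : cmd) (C : nat), forall (n t : nat) (i : 'I_n), (0 < t)%N ->
  exists out : Om -> 'M[bool]_(t.-1, n) -> bool,
    (forall w h, computes_within mu0 mu1 f c i w h (C * (n * t))%N (out w h)) /\
    (forall (d' : measure_display) (T : measurableType d') (P : probability T R)
        (S : {mfun T >-> bool}) (W : 'I_n -> {mfun T >-> Om})
        (V : nat -> 'I_n -> T -> bool),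
      has_joint_law P S W mu0 mu1 -> is_vote_process P S W V ->
      {ae P, forall e, V t i e = out (W i e) (history V t e)}).
Proof.
move=> fP; exists vote_program, program_constant => n t i t0.
exists (fun w h => decision (input_env mu0 mu1 f w h) n t i); split.
  move=> w h; have [||s' [k kle ek] out] :=
    @vote_program_correct _ (input_env mu0 mu1 f w h) n t i _ _ (ltn_ord i).
  - by case.
  - by case.
  exists k, s'; split=> //; apply: leq_trans kle _.
  by apply: program_cost_linear => //; exact: leq_ltn_trans (ltn_ord i).
case: t t0 => // m _ d' T P S W V law VP.
have pos : {ae P, forall e (h : 'M[bool]_(m, n)) l,
    same_votes V (table h) m e -> mu0 (cell mu0 mu1 f (table h) m l) != 0}.
  apply: filter_forall => h; apply: filter_forall => l.
  exact: (same_votes_pos fP law VP).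
apply: filterS2 (vote_rational fP law VP m) pos => e rat pos.
set h := history V m.+1 e; rewrite {}rat /decision /=.
have votesE k (km : (k < m)%N) := table_history V e km.
rewrite (eq_cell _ _ _ votesE).
have {}pos l := pos h l (fun k km => votesE k km).
pose E := input_env mu0 mu1 f (W i e) h.
have Eu k (l : 'I_n) : (k < m)%N -> env_vote E k l = table h k l.
  move=> km; rewrite /= /read_vote /table insubT; case: insubP => [l' _ ll'|].
    by congr (nat_of_bool (h _ _)); exact: val_inj.
  by rewrite ltn_ord.
have EF : env_cdf E = cdf_oracle mu0 mu1 f by [].
have [-> th0] := cutoffE fP EF i pos
  (bounds_tracked fP EF Eu (leqnn m) pos).
have [_ _ _ f0 _] := fP.
by rewrite lne_EFin// lte_fin ltr_ln// posrE.
Qed.
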